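(* Let $(Z_n)_n$ be the simple random walk on the free group $\mathbb{F}_2$ with respect to the standard generating set, starting at the identity. There exists a bijective quasi-isometry $f:\mathbb{F}_2\to\mathbb{F}_2$ such that the push-forward $(w_n^{f(1)})_n$ of $(Z_n)_n$ by $f$ does not have well-defined drift, i.e. the limit $\lim_{n\to\infty}\frac{\mathbb{E}[d(f(1),w_n^{f(1)})]}{n}$ does not exist.
   Context: $d$ is the word metric on $\mathbb{F}_2$ with respect to the standard (free) generating set. The simple random walk on $\mathbb{F}_2$ is the Markov chain which moves from $g$ to each of its four neighbours $gs$ ($s$ a standard generator or inverse of one) with probability $1/4$. Push-forward: given finitely generated groups $G,H$, a bijection $f:G\to H$ and a Markov chain on $G$ with transition probabilities $p_G(\cdot,\cdot)$, the push-forward by $f$ is the Markov chain on $H$ with transition probabilities $p_H(g,h)=p_G(f^{-1}(g),f^{-1}(h))$ for all $g,h\in H$. Here $w_n^p$ denotes the position after $n$ steps of the push-forward chain started at $p$; for $(Z_n)_n$ started at the identity, $w_n^{f(1)}$ has the same distribution as $f(Z_n)$. The drift of a Markov chain $(w_n^p)_n$ started at $p$ is $\lim_{n\to\infty}\mathbb{E}[d(p,w_n^p)]/n$; it is well-defined if this limit exists. *)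

(* Defs.v *)
From HB Require Import structures.
From mathcomp Require Import all_boot all_order all_algebra.
From mathcomp Require Import all_classical all_reals all_analysis.
From mathcomp Require Import ring.
Set Implicit Arguments.
Unset Strict Implicit.
Unset Printing Implicit Defensive.
Import Order.TTheory GRing.Theory Num.Theory.
Import numFieldNormedType.Exports.

Section FreeGroup.
Variable X : choiceType.

(* The letter (x, true) stands for x and (x, false) for its inverse. *)
Definition letter : Type := X * bool.
Definition letter_inv (l : letter) : letter := (l.1, ~~ l.2).

Definition reduced (w : seq letter) : bool :=
  sorted (fun l m => m != letter_inv l) w.

Record free_group := FreeGroup { fg_word :> seq letter; _ : reduced fg_word }.

HB.instance Definition _ := [isSub for fg_word].
HB.instance Definition _ := [Choice of free_group by <:].

(* The product of reduced words is obtained by letting the letters of the left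
   factor act one by one, with cancellation, on the right factor. *)
Definition fg_push (l : letter) (w : seq letter) : seq letter :=
  if w is m :: w' then if m == letter_inv l then w' else l :: w else [:: l].

Lemma letter_invK : involutive letter_inv.
Proof. by case=> x b; rewrite /letter_inv /= negbK. Qed.

Lemma fg_push_reduced l w : reduced w -> reduced (fg_push l w).
Proof.
case: w => [|m w] //= red_mw.
case: eqP => [_|/eqP neq_ml]; first exact: path_sorted red_mw.
by rewrite /= neq_ml.
Qed.

Lemma fg_pushK l w : reduced w -> fg_push (letter_inv l) (fg_push l w) = w.
Proof.
case: w => [|m w] /=; first by rewrite letter_invK eqxx.
case: eqP => [->|_] /=; last by rewrite letter_invK eqxx.
by case: w => [|k w] //= /andP[/negPf -> _].
Qed.

Definition fg_mulw (u w : seq letter) : seq letter := foldr fg_push w u.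

Lemma fg_mulw_reduced u w : reduced w -> reduced (fg_mulw u w).
Proof. by move=> red_w; elim: u => //= l u; apply: fg_push_reduced. Qed.

Lemma fg_mulw1 u : reduced u -> fg_mulw u [::] = u.
Proof.
elim: u => //= l u IHu red_lu; rewrite IHu; last exact: path_sorted red_lu.
by case: u red_lu {IHu} => //= m u /andP[/negPf ->] _.
Qed.

Lemma fg_mulw_push l u w :
  reduced w -> fg_mulw (fg_push l u) w = fg_push l (fg_mulw u w).
Proof.
move=> red_w; case: u => [|m u] //=; case: eqP => [->|//] /=.
have := fg_pushK (letter_inv l) (fg_mulw_reduced u red_w).
by rewrite letter_invK.
Qed.

Lemma fg_mulwA u v w :
  reduced w -> fg_mulw (fg_mulw u v) w = fg_mulw u (fg_mulw v w).
Proof. by move=> red_w; elim: u => //= l u IHu; rewrite fg_mulw_push ?IHu. Qed.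

Definition fg_invw (u : seq letter) : seq letter := rev (map letter_inv u).

Lemma fg_invw_reduced u : reduced u -> reduced (fg_invw u).
Proof.
rewrite /reduced /fg_invw rev_sorted sorted_map; apply: sub_sorted => l m /=.
by apply: contra => /eqP e; rewrite -[m]letter_invK -e.
Qed.

Lemma fg_mulVw u w : reduced w -> fg_mulw (fg_invw u) (fg_mulw u w) = w.
Proof.
elim: u w => //= l u IHu w red_w.
rewrite /fg_invw /= rev_cons {1}/fg_mulw foldr_rcons.
by rewrite fg_pushK; [exact: IHu | exact: fg_mulw_reduced].
Qed.

Lemma fg_invwK : involutive fg_invw.
Proof.
by move=> u; rewrite /fg_invw map_rev revK -map_comp map_id_in // => l _ /=;
  rewrite letter_invK.
Qed.

Lemma fg_wordP (u : free_group) : reduced u. Proof. by case: u. Qed.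

Definition fg_one : free_group := @FreeGroup [::] isT.
Definition fg_mul (u v : free_group) : free_group :=
  FreeGroup (fg_mulw_reduced u (fg_wordP v)).
Definition fg_inv (u : free_group) : free_group :=
  FreeGroup (fg_invw_reduced (fg_wordP u)).

Lemma fg_mulA : associative fg_mul.
Proof. by move=> u v w; apply: val_inj; rewrite /= fg_mulwA ?fg_wordP. Qed.
Lemma fg_mul1g : left_id fg_one fg_mul.
Proof. by move=> u; apply: val_inj. Qed.
Lemma fg_mulg1 : right_id fg_one fg_mul.
Proof. by move=> u; apply: val_inj; rewrite /= fg_mulw1 ?fg_wordP. Qed.
Lemma fg_mulVg : left_inverse fg_one fg_inv fg_mul.
Proof.
move=> u; apply: val_inj => /=.
by rewrite -{2}[fg_word u]fg_mulw1 ?fg_wordP // fg_mulVw.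
Qed.
Lemma fg_mulgV : right_inverse fg_one fg_inv fg_mul.
Proof.
move=> u; rewrite -(fg_mulVg (fg_inv u)); congr fg_mul; apply: val_inj.
by rewrite /= fg_invwK.
Qed.

HB.instance Definition _ :=
  isGroup.Build free_group fg_mulA fg_mul1g fg_mulg1 fg_mulVg fg_mulgV.

Definition fg_gen (x : X) : free_group := @FreeGroup [:: (x, true)] isT.

End FreeGroup.

Definition F2 : Type := free_group bool.
HB.instance Definition _ := Group.on F2.

Definition genF2 (i : bool) : F2 := fg_gen i.
Definition std_genF2 : set F2 := range genF2.

Section WordMetric.
Local Open Scope classical_set_scope.
Local Open Scope ring_scope.
Variables (R : realType) (G : groupType) (S : set G).

(* Distance in the (right) Cayley graph: least length of a word in S and S^-1
   representing g^-1 h. The infimum is a minimum when S generates G. *)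
Definition word_metric (g h : G) : R :=
  inf [set (size w)%:R | w in
    [set w : seq G | (forall s, s \in w -> S s \/ S (s^-1)%g) /\
                     (\prod_(s <- w) s = g^-1 * h)%g]].

End WordMetric.

Section QuasiIsometry.
Local Open Scope ring_scope.
Variables (R : realType) (X Y : Type) (dX : X -> X -> R) (dY : Y -> Y -> R).

Definition quasi_isometry (f : X -> Y) : Prop :=
  exists K C : R, [/\ 1 <= K, 0 <= C,
    (forall x x', K^-1 * dX x x' - C <= dY (f x) (f x')
                  /\ dY (f x) (f x') <= K * dX x x' + C) &
    (forall y, exists x, dY (f x) y <= C)].

End QuasiIsometry.

Section MarkovChain.
Local Open Scope classical_set_scope.
Local Open Scope ring_scope.
Local Open Scope ereal_scope.
Variable R : realType.

Record markov_chain (T : choiceType) := MarkovChain {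
  trans :> T -> T -> R;
  trans_ge0 : forall x y, (0 <= trans x y)%R;
  trans_sum1 : forall x, \esum_(y in [set: T]) (trans x y)%:E = 1 }.

Section Drift.
Variables (T : choiceType) (p : markov_chain T).

(* n-step transition probabilities, i.e. the law of w_n for the chain started
   at x. *)
Fixpoint step_prob (n : nat) (x y : T) : \bar R :=
  if n is m.+1 then \esum_(z in [set: T]) ((p x z)%:E * step_prob m z y)
  else (x == y)%:R%:E.

(* The expectation of phi (w_n) for the chain (w_n) started at x, as a
   sum against the law of w_n; esum is meaningful since phi is
   nonnegative below. *)
Definition expect_step (n : nat) (x : T) (phi : T -> R) : \bar R :=
  \esum_(y in [set: T]) (step_prob n x y * (phi y)%:E).

(* The term n = 0 carries the junk value 0 and does not affect the limit. *)
Definition mean_speed (d : T -> T -> R) (x : T) (n : nat) : \bar R :=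
  expect_step n x (d x) * (n%:R^-1)%R%:E.

(* Convergence is in the extended reals, so that divergence to +oo would count
   as an (infinite) drift; [~ has_drift] is genuine oscillation. *)
Definition has_drift (d : T -> T -> R) (x : T) : Prop :=
  cvgn (mean_speed d x).

End Drift.

Section PushForward.
Variables (G H : choiceType) (p : markov_chain G) (f : G -> H) (finv : H -> G).
Hypotheses (fK : cancel f finv) (finvK : cancel finv f).

Lemma push_forward_subproof g :
  \esum_(h in [set: H]) (p (finv g) (finv h))%:E = 1.
Proof.
rewrite (@reindex_esum R G H [set: G] [set: H] f).
  by under eq_esum do rewrite fK; exact: trans_sum1.
by rewrite setTT_bijective; exists finv.
Qed.

Definition push_forward : markov_chain H :=
  @MarkovChain H (fun g h => p (finv g) (finv h))
    (fun g h => trans_ge0 p (finv g) (finv h)) push_forward_subproof.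

End PushForward.

End MarkovChain.

Section SimpleRandomWalk.
Local Open Scope classical_set_scope.
Local Open Scope ring_scope.
Variable R : realType.

Definition neighbourF2 (g : F2) : seq F2 :=
  [seq (g * s)%g | s <- [:: genF2 true; (genF2 true)^-1%g;
                            genF2 false; (genF2 false)^-1%g]].

Definition srwF2_trans (g h : F2) : R :=
  if h \in neighbourF2 g then 4^-1 else 0.

Lemma srwF2_trans_ge0 g h : 0 <= srwF2_trans g h.
Proof. by rewrite /srwF2_trans; case: ifP => // _; rewrite invr_ge0. Qed.

Lemma neighbourF2_uniq g : uniq (neighbourF2 g).
Proof. by rewrite map_inj_uniq //; exact: mulgI. Qed.

Lemma srwF2_trans_sum1 g :
  (\esum_(h in [set: F2]) (srwF2_trans g h)%:E = 1)%E.
Proof.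
transitivity (\esum_(h in [set: F2])
    (\sum_(s <- neighbourF2 g) if h == s then (4^-1 : R)%:E else 0))%E.
  apply: eq_esum => h _; rewrite /srwF2_trans -big_mkcond /= big_const_seq.
  rewrite (eq_count (a2 := pred1 h)); last by move=> s; rewrite /= eq_sym.
  rewrite count_uniq_mem ?neighbourF2_uniq //.
  by case: (h \in _); rewrite /= ?adde0.
rewrite esum_sum; last by move=> h s _ _; case: ifP => // _; rewrite lee_fin invr_ge0.
under eq_bigr => s _.
  have -> : (\esum_(h in [set: F2]) (if h == s then (4^-1 : R)%:E else 0)
             = (4^-1 : R)%:E)%E.
    rewrite -[RHS](@esum_set1 R F2 s (fun=> (4^-1 : R)%:E)) ?lee_fin ?invr_ge0 //.
    rewrite [RHS]esum_mkcond; apply: eq_esum => h _.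
    by case: eqP => [->|neq_hs]; [rewrite mem_set | rewrite memNset].
  over.
rewrite big_const_seq count_predT /= adde0 -!EFinD.
by congr EFin; field.
Qed.

Definition srwF2 : markov_chain R F2 :=
  MarkovChain srwF2_trans_ge0 srwF2_trans_sum1.

End SimpleRandomWalk.

(* Main.v *)
Require Import Defs.
From mathcomp Require Import all_boot all_order all_algebra.
From mathcomp Require Import all_classical all_reals all_analysis.
From mathcomp Require Import zify ring lra.
Set Implicit Arguments.
Unset Strict Implicit.
Unset Printing Implicit Defensive.
Import Order.TTheory GRing.Theory Num.Theory.

(** A reduced word factors into runs s_1^e_1 s_2^e_2 ... s_m^e_m of repeated
    letters, and toggling a run means exchanging the lengths 2i-1 and 2i.  For
    a set s of indices, [toggle s] toggles every run, except the last one,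
    whose index lies in s.  Runs keep their letters, so this is an involution
    of F2; and since appending a letter changes the image only near its end,
    it is Lipschitz ([toggle_lipschitz]), hence a bijective quasi-isometry.

    Toggling all runs speeds the walk up.  The geodesic followed by the walk
    repeats its last letter with probability 1/3, so run lengths are geometric:
    a run is odd, and gains a letter, with probability 3/4, and is even, and
    loses one, with probability 1/4.  The average run grows from 3/2 to 2 and
    the speed from 1/2 to 2/3.  It is enough to prove that the mean length is
    at most n/2 + 3/4 for the walk itself ([avg_iter_len]) and at least 9n/16
    for its toggled image ([avg_iter_len_toggle]).  Both follow by exhibiting a
    function on the tree that compares with the length and whose mean over the
    neighbours of a vertex exceeds its value there by at most 1/2, respectively
    at least 9/16.

    To make the speed oscillate, runs are toggled or not according to the
    parity of the scale j for which their index lies in [64^j, 64^(j+1)).  At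
    time n = 64^(j+1) the walk is inside the ball of radius n, where the
    map differs from toggling all runs, or none, only in the first n/64 runs,
    and each run matters for at most one letter ([len_toggle_agree]).  The mean
    speeds at these times are thus at least 35/64 for odd j and at most 34/64
    for even j, and they have no limit. *)

(** * Words and lengths in the free group *)

Section FreeGroupWords.
Variable X : choiceType.
Implicit Types (u v w : seq (letter X)) (l : letter X).

Lemma size_fg_push l w : size (fg_push l w) <= (size w).+1.
Proof. by case: w => [|m w] //=; case: ifP => //= _; lia. Qed.

Lemma size_fg_mulw u w : size (fg_mulw u w) <= size u + size w.
Proof.
elim: u => //= l u IHu; have := size_fg_push l (fg_mulw u w).
by move=> /leq_trans; apply; rewrite addSn ltnS.
Qed.

Lemma size_fg_invw u : size (fg_invw u) = size u.
Proof. by rewrite size_rev size_map. Qed.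

Lemma reduced_catr u w : reduced (u ++ w) -> reduced w.
Proof. by rewrite /reduced; elim: u => //= l u IHu /path_sorted. Qed.

Lemma fg_mulw_cat u w : reduced (u ++ w) -> fg_mulw u w = u ++ w.
Proof.
move=> red_uw; have := fg_mulw1 red_uw; rewrite /fg_mulw foldr_cat.
by rewrite [foldr _ _ w](fg_mulw1 (reduced_catr red_uw)).
Qed.

(** The common prefix u cancels, so two words are at most as far apart as the
    lengths of what follows it. *)
Lemma size_fg_divw u v w : reduced (u ++ w) ->
  size (fg_mulw (fg_invw (u ++ v)) (u ++ w)) <= size v + size w.
Proof.
move=> red_uw; rewrite -(fg_mulw_cat red_uw) /fg_invw map_cat rev_cat.
rewrite /fg_mulw foldr_cat -!/(fg_mulw _ _) fg_mulVw.
  by rewrite -[size v]size_fg_invw size_fg_mulw.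
exact: reduced_catr red_uw.
Qed.

Lemma reduced_rcons w p l :
  reduced (rcons w p) -> reduced (rcons (rcons w p) l) = (l != letter_inv p).
Proof.
case: w => [|m w]; rewrite /reduced /= ?andbT // => red_wp.
by rewrite rcons_path red_wp last_rcons.
Qed.

Lemma fg_mulw_rcons w p l : reduced (rcons w p) ->
  fg_mulw (rcons w p) [:: l] =
    if l == letter_inv p then w else rcons (rcons w p) l.
Proof.
move=> red_wp; case: ifPn => [/eqP ->|l_p].
  rewrite /fg_mulw foldr_rcons /= eqxx -/(fg_mulw _ _) fg_mulw1 //.
  by case: w red_wp => //= m w; rewrite /reduced /= rcons_path => /andP[].
by rewrite fg_mulw_cat cats1 // reduced_rcons.
Qed.

End FreeGroupWords.

Definition letterF2 (l : letter bool) : F2 := @FreeGroup _ [:: l] isT.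

Local Notation len g := (size (fg_word g)).

Lemma len_mul (g h : F2) : len (g * h)%g <= len g + len h.
Proof. exact: size_fg_mulw. Qed.

Lemma prod_lettersF2 (g : F2) : (\prod_(l <- fg_word g) letterF2 l)%g = g.
Proof.
have H w : fg_word (\prod_(l <- w) letterF2 l)%g = fg_mulw w [::].
  by elim: w => [|l w IHw]; rewrite ?big_nil // big_cons /= IHw.
by apply: val_inj; rewrite /= H fg_mulw1 // fg_wordP.
Qed.

Section LengthMetric.
Variable R : realType.

Lemma word_metricE (g h : F2) :
  word_metric R std_genF2 g h = (len (g^-1 * h)%g)%:R%R.
Proof.
rewrite /word_metric; set S := image _ _; set x := (g^-1 * h)%g.
have Sx : S ((len x)%:R)%R.
  exists (map letterF2 (fg_word x)); last by rewrite size_map.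
  split; last by rewrite big_map prod_lettersF2.
  move=> _ /mapP[[i [|]] _ ->]; [left|right]; exists i => //; exact: val_inj.
have lbx : lbound S (len x)%:R%R.
  move=> _ [w [w_gen wx] <-]; rewrite /x -wx ler_nat {wx}.
  elim: w w_gen => [|s w IHw] w_gen; first by rewrite big_nil.
  rewrite big_cons /=; apply: leq_trans (len_mul _ _) _; rewrite -add1n.
  rewrite leq_add ?IHw // => [|t tw]; last by apply: w_gen; rewrite inE tw orbT.
  case: (w_gen s); rewrite ?inE ?eqxx // => -[i _].
    by move=> <-.
  by move=> /(congr1 (fun t => t^-1)%g); rewrite invgK => <-.
apply/eqP; rewrite eq_le; apply/andP; split.
  by apply: inf_lbound => //; exists (len x)%:R%R.
by apply: lb_le_inf => //; exists (len x)%:R%R.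
Qed.

End LengthMetric.

(** * Toggling the runs of a reduced word *)

Section Toggle.
Variable s : nat -> bool.
Implicit Types (p q l : letter bool) (w : seq (letter bool)).

(** The word is rewritten letter by letter.  The state consists of the last
    letter read p, the number k of completed runs, and a bit b that holds when
    the current run has even length; its last letter is then withheld, because
    it has to be dropped if the run ends here and is to be toggled.  [emit]
    gives the letters produced when q is read: a repeated letter completes an
    odd length or is withheld, and a turn releases or drops the withheld letter
    of an even run, or lengthens an odd one.  The last run always recovers its
    withheld letter, so that its length does not change. *)
Definition emit (sk b : bool) p q : seq (letter bool) :=
  if q == p then (if b then [:: p; q] else [::])
  else if sk (+) b then [:: p; q] else [:: q].

Fixpoint toggle_run (k : nat) (b : bool) p w : seq (letter bool) :=
  if w is q :: w' then
    emit (s k) b p q ++ toggle_run (k + (q != p)) (~~ b && (q == p)) q w'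
  else if b then [:: p] else [::].

Definition toggle_word w :=
  if w is l :: w' then l :: toggle_run 0 false l w' else [::].

Lemma toggle_runK k b p w :
  toggle_run k false p (toggle_run k b p w) = if b then p :: w else w.
Proof.
elim: w k b p => [|q w IHw] k b p /=.
  by case: b => //=; rewrite /emit eqxx.
rewrite /emit; case: (eqVneq q p) => [->|qp].
  by case: b; rewrite /= ?addn0 /emit /= ?eqxx /= ?addn0 ?IHw.
by case sk: (s k); case: b;
  rewrite /= /emit !(eqxx, negPf qp, addn0, addn1, sk) /=
    ?(eqxx, negPf qp, sk, addn0, addn1) /= ?IHw.
Qed.

Lemma toggle_wordK : involutive toggle_word.
Proof. by case=> //= l w; rewrite toggle_runK. Qed.

Lemma toggle_run_reduced k b p w :
  path (fun l m => m != letter_inv l) p w ->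
  path (fun l m => m != letter_inv l) p (toggle_run k b p w).
Proof.
have pp q : q != letter_inv q by case: q => -[] [].
elim: w k b p => [|q w IHw] k b p /=; first by case: b; rewrite //= pp.
move=> /andP[qp red_w]; rewrite /emit.
case: (eqVneq q p) => [eqp|_].
  by subst q; case: b => /=; rewrite ?pp IHw.
by case: ifP; rewrite /= ?pp qp IHw.
Qed.

Lemma toggle_word_reduced w : reduced w -> reduced (toggle_word w).
Proof. by case: w => //= l w; apply: toggle_run_reduced. Qed.

Definition toggle (g : F2) : F2 :=
  FreeGroup (toggle_word_reduced (fg_wordP g)).

Lemma toggleK : involutive toggle.
Proof. by move=> g; apply: val_inj; rewrite /= toggle_wordK. Qed.

Lemma toggle1 : toggle 1%g = 1%g. Proof. exact: val_inj. Qed.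

(** What is emitted before the appended letter is read is common to both
    outputs; the rest is the withheld letter on one side, and the last emission
    with a newly withheld letter on the other. *)
Lemma toggle_run_rcons k b p w l :
  exists u v v', [/\ toggle_run k b p w = u ++ v,
    toggle_run k b p (rcons w l) = u ++ v', size v <= 1 & size v' <= 2].
Proof.
elim: w k b p => [|q w IHw] k b p /=.
  exists [::], (if b then [:: p] else [::]),
    (emit (s k) b p l ++ if ~~ b && (l == p) then [:: l] else [::]).
  split=> //; first by case: b.
  by rewrite /emit; case: (l == p); case: b; case: (s k).
have [u [v [v' [-> -> v1 v2]]]] := IHw (k + (q != p)) (~~ b && (q == p)) q.
by exists (emit (s k) b p q ++ u), v, v'; rewrite !catA.
Qed.

Lemma toggle_word_rcons w l :
  exists u v v', [/\ toggle_word w = u ++ v,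
    toggle_word (rcons w l) = u ++ v', size v <= 1 & size v' <= 2].
Proof.
case: w => [|p w] /=; first by exists [::], [::], [:: l].
have [u [v [v' [-> -> v1 v2]]]] := toggle_run_rcons 0 false p w l.
by exists (p :: u), v, v'.
Qed.

Lemma toggle_neighbour (g : F2) l :
  len ((toggle g)^-1 * toggle (g * letterF2 l))%g <= 3.
Proof.
case: g => w red_w.
(* A neighbour of g is g with a letter appended, or conversely. *)
have H w1 w2 (r1 : reduced w1) (r2 : reduced w2) m :
    w2 = rcons w1 m \/ w1 = rcons w2 m ->
    size (fg_mulw (fg_invw (toggle_word w1)) (toggle_word w2)) <= 3.
  have := toggle_word_reduced r1; have := toggle_word_reduced r2.
  move=> + + [e|e]; subst.
    have [u [v [v' [-> -> v1 v2]]]] := toggle_word_rcons w1 m.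
    by move=> red _; apply: leq_trans (size_fg_divw v red) (leq_add v1 v2).
  have [u [v [v' [-> -> v1 v2]]]] := toggle_word_rcons w2 m.
  by move=> red _; apply: leq_trans (size_fg_divw v' red) (leq_add v2 v1).
pose h := (FreeGroup red_w * letterF2 l)%g.
case/lastP: w red_w @h => [|w p] red_w h.
  exact: (H [::] [:: l] isT isT l (or_introl _)).
have := fg_mulw_rcons l red_w; case: ifP => _ eh.
  by apply: (H _ _ red_w (fg_wordP h) p); right; rewrite [fg_word h]eh.
by apply: (H _ _ red_w (fg_wordP h) l); left; rewrite [fg_word h]eh.
Qed.

Lemma toggle_lipschitz (g h : F2) :
  len ((toggle g)^-1 * toggle h)%g <= 3 * len (g^-1 * h)%g.
Proof.
have eh : h = (g * \prod_(l <- fg_word (g^-1 * h)) letterF2 l)%g.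
  by rewrite prod_lettersF2 mulVKg.
rewrite {1}eh; move: (fg_word (g^-1 * h)%g) => w {eh}.
elim: w g => [|l w IHw] g.
  by rewrite big_nil mulg1 mulVg.
rewrite big_cons mulgA.
set x := (\prod_(_ <- w) _)%g; set y := toggle (g * letterF2 l)%g.
have -> : ((toggle g)^-1 * toggle (g * letterF2 l * x) =
  ((toggle g)^-1 * y) * (y^-1 * toggle (g * letterF2 l * x)))%g.
  by rewrite -[RHS]mulgA mulVKg.
apply: leq_trans (len_mul _ _) _.
by rewrite mulnS leq_add ?toggle_neighbour ?IHw.
Qed.

(** The lower bound of a quasi-isometry is the Lipschitz bound for the inverse
    map, which is the same map. *)
Lemma toggle_quasi_isometry (R : realType) :
  quasi_isometry (word_metric R std_genF2) (word_metric R std_genF2) toggle.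
Proof.
exists 3%R, 0%R; split=> [||g h|h].
- by rewrite ler1n.
- by [].
- have := toggle_lipschitz g h; have := toggle_lipschitz (toggle g) (toggle h).
  rewrite !toggleK !word_metricE -!(ler_nat R) !natrM => h1 h2.
  by split; lra.
- by exists (toggle h); rewrite toggleK word_metricE mulVg.
Qed.

End Toggle.

(** The state does not depend on the set of toggled runs, so two such sets lead
    to outputs that differ by one letter for each run on which they disagree;
    K - k bounds the number of these that are still to come. *)
Lemma size_toggle_run_agree (s t : nat -> bool) (K N k : nat) b p w :
    (forall i, K <= i < N -> s i = t i) -> k + size w <= N ->
  size (toggle_run s k b p w) <= size (toggle_run t k b p w) + (K - k).
Proof.
move=> st; elim: w k b p => [|q w IHw] k b p /=; first by rewrite leq_addr.
move=> kN; rewrite !size_cat.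
have := IHw (k + (q != p)) (~~ b && (q == p)) q; rewrite /emit.
case: (eqVneq q p) => [_|_] /=; first by rewrite addn0; lia.
case: (leqP K k) => Kk.
  by rewrite st; [case: ifP => /= _; lia|lia].
by case: ifP; case: ifP => /= _ _; lia.
Qed.

Lemma len_toggle_agree (s t : nat -> bool) (K N : nat) (g : F2) :
    (forall i, K <= i < N -> s i = t i) -> len g <= N ->
  len (toggle s g) <= len (toggle t g) + K.
Proof.
move=> st; case: g => [[|p w] red_w] //= wN.
by have := @size_toggle_run_agree s t K N 0 false p w st; lia.
Qed.

Lemma toggle_run_false k b p w :
  toggle_run (fun=> false) k b p w = if b then p :: w else w.
Proof.
elim: w k b p => [|q w IHw] k b p //=.
by rewrite IHw /emit; case: (eqVneq q p) => [->|]; case: b.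
Qed.

Lemma toggle_false g : toggle (fun=> false) g = g.
Proof.
by apply: val_inj; case: g => [[|p w] ?] //=; rewrite toggle_run_false.
Qed.

(** * Mean growth of functions along the walk *)

Section Averaging.
Local Open Scope ring_scope.
Variable R : realType.
Implicit Types (phi psi : F2 -> R) (g : F2) (Psi : seq (letter bool) -> R).

Definition letters : seq (letter bool) :=
  [:: (true, true); (true, false); (false, true); (false, false)].

(** The transition operator of the walk: its n-th iterate at g is the mean value
    of phi after n steps from g. *)
Definition avg phi g : R := (\sum_(l <- letters) phi (g * letterF2 l)%g) / 4.

(** In the tree, the neighbours of a vertex w p are its parent w and three
    children: p can be repeated, or be followed by the other generator with
    either sign. *)
Lemma avg_word Psi g w p : fg_word g = rcons w p ->
  avg (fun h => Psi (fg_word h)) g =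
    (Psi w + Psi (rcons (rcons w p) p)
       + Psi (rcons (rcons w p) (~~ p.1, true))
       + Psi (rcons (rcons w p) (~~ p.1, false))) / 4.
Proof.
move=> gwp; have red_wp : reduced (rcons w p) by rewrite -gwp fg_wordP.
rewrite /avg !big_cons big_nil /= gwp !fg_mulw_rcons //.
by case: p {gwp red_wp} => -[] []; congr (_ / _); rewrite /=; ring.
Qed.

Lemma avg_word1 Psi :
  avg (fun h => Psi (fg_word h)) 1%g = (\sum_(l <- letters) Psi [:: l]) / 4.
Proof. by rewrite /avg !big_cons !big_nil. Qed.

Lemma iter_avgZ n (c : R) phi g :
  iter n avg (fun h => c * phi h) g = c * iter n avg phi g.
Proof.
elim: n g => // n IHn g; rewrite !iterS /avg mulrA; congr (_ / _).
by rewrite mulr_sumr; apply: eq_bigr => l _; rewrite IHn.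
Qed.

(** In n steps the walk cannot leave the ball of radius n around its starting
    point. *)
Lemma le_iter_avg n phi psi g :
    (forall h, (len h <= len g + n)%N -> phi h <= psi h) ->
  iter n avg phi g <= iter n avg psi g.
Proof.
elim: n g => [|n IHn] g le_phi /=; first by rewrite le_phi ?addn0.
rewrite ler_pM2r ?invr_gt0 //; apply: ler_sum => l _; apply: IHn => h le_h.
by apply: le_phi; have := len_mul g (letterF2 l); rewrite /= in le_h *; lia.
Qed.

Lemma iter_avg_superharmonic n phi (c : R) g :
  (forall h, avg phi h <= phi h + c) -> iter n avg phi g <= phi g + n%:R * c.
Proof.
move=> phi_c; elim: n g => [|n IHn] g /=; first by rewrite mul0r addr0.
have -> : phi g + n.+1%:R * c = phi g + c + n%:R * c.
  by rewrite -[n.+1%:R]natr1; ring.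
apply: (@le_trans _ _ (avg (fun h => phi h + n%:R * c) g)).
  by rewrite ler_pM2r ?invr_gt0 // ler_sum.
by have := phi_c g; rewrite /avg big_split /= !big_cons !big_nil; lra.
Qed.

Lemma iter_avg_subharmonic n phi (c : R) g :
  (forall h, phi h + c <= avg phi h) -> phi g + n%:R * c <= iter n avg phi g.
Proof.
move=> phi_c; rewrite -lerN2 -mulN1r -iter_avgZ opprD -mulrN -[- phi g]mulN1r.
apply: (@iter_avg_superharmonic n (fun h => -1 * phi h) (- c)) => h.
by have := iter_avgZ 1 (-1) phi h; rewrite /= => ->; have := phi_c h; lra.
Qed.

(** The length has drift 1/2 except at the identity, where the drift is 1.  The
    function 3^-|g| is harmonic except at the identity, where its mean over the
    neighbours is 1/3 instead of 1, so that adding 3/4 of it makes the drift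
    equal to 1/2 everywhere. *)
Lemma avg_iter_len n (g : F2) :
  iter n avg (fun h => (len h)%:R) g <= (len g)%:R + n%:R / 2 + 3 / 4.
Proof.
pose Psi (w : seq (letter bool)) : R := (size w)%:R + 3 / 4 * 3^-1 ^+ size w.
have le0 k : 0 <= 3 / 4 * 3^-1 ^+ k :> R.
  by rewrite mulr_ge0 // exprn_ge0 ?invr_ge0.
apply: (@le_trans _ _ (iter n avg (fun h => Psi (fg_word h)) g)).
  by apply: le_iter_avg => h _; rewrite lerDl.
apply: (@le_trans _ _ (Psi (fg_word g) + n%:R * 2^-1)).
  apply: iter_avg_superharmonic => h.
  case/lastP hE: (fg_word h) => [|w p].
    rewrite (_ : h = 1%g); last by apply: val_inj; rewrite /= hE.
    by rewrite avg_word1 !big_cons !big_nil /Psi /=; lra.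
  rewrite (avg_word _ hE) /Psi !size_rcons -(natr1 (size w).+1).
  rewrite -(natr1 (size w)) !exprS.
  by move: (3^-1 ^+ size w : R) => x; lra.
suff : 3^-1 ^+ len g <= 1 :> R by rewrite /Psi; lra.
by rewrite exprn_ile1 ?invr_ge0 // invf_le1 ?ler1n.
Qed.

(** * Growth of the length when all runs are toggled *)

(** The bit of the state of [toggle_run] after w has been read. *)
Fixpoint parity (b : bool) (p : letter bool) (w : seq (letter bool)) : bool :=
  if w is q :: w' then parity (~~ b && (q == p)) q w' else b.

(** The length of the toggled word has no drift at the vertices with an even
    last run: only one child lies further out, and the parent is nearer.
    Lowering the height of these vertices by a weight c <= 1 gives them the
    drift c and leaves at least (3 - c)/4 to the others; both exceed 1/2 for
    c = 3/4. *)
Definition run_height b p w : R :=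
  (size (toggle_run (fun=> true) 0 b p w))%:R - 3 / 4 * (parity b p w)%:R.

Definition height (w : seq (letter bool)) : R :=
  if w is p :: w' then 1 + run_height false p w' else 0.

(** The change of height on an edge of the tree: b is the parity bit of the end
    nearer to the root, p the last letter there, and q the letter appended. *)
Definition climb (b : bool) (p q : letter bool) : R :=
  if b then (if q == p then 7 / 4 else 3 / 4)
  else (if q == p then 1 / 4 else 2).

Lemma toggle_run_true k b p w :
  toggle_run (fun=> true) k b p w = toggle_run (fun=> true) 0 b p w.
Proof. by elim: w k b p => //= q w IHw k b p; rewrite IHw [in RHS]IHw. Qed.

Lemma run_height_rcons b p w q :
  run_height b p (rcons w q) =
    run_height b p w + climb (parity b p w) (last p w) q.
Proof.
rewrite /run_height; elim: w b p => [|r w IHw] b p /=.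
  by rewrite /emit /climb; case: eqVneq; case: b => _ /=; lra.
rewrite toggle_run_true (toggle_run_true _ _ _ w) !size_cat !natrD.
have := IHw (~~ b && (r == p)) r; lra.
Qed.

Lemma parity_rcons b p w q :
  parity b p (rcons w q) = ~~ parity b p w && (q == last p w).
Proof. by elim: w b p => //= r w IHw b p; rewrite IHw. Qed.

(** At a vertex with an even last run the children climb by 7/4, 3/4 and 3/4 and
    the parent is 1/4 below, which gives the drift 3/4.  With an odd last run
    the children climb by 1/4, 2 and 2 and the parent is at most 2 below, which
    gives at least 9/16. *)
Lemma avg_height (g : F2) :
  height (fg_word g) + 9 / 16 <= avg (fun h => height (fg_word h)) g.
Proof.
have turn (p : letter bool) (b : bool) : ((~~ p.1, b) == p) = false.
  by case: p => -[] []; case: b.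
case/lastP gE: (fg_word g) => [|w p].
  rewrite (_ : g = 1%g); last by apply: val_inj; rewrite /= gE.
  by rewrite avg_word1 !big_cons big_nil /height /run_height /=; lra.
rewrite (avg_word _ gE); case: w gE => [|l w] gE /=.
  by rewrite /run_height /= /emit !turn !eqxx /=; lra.
rewrite !run_height_rcons parity_rcons !last_rcons /climb !turn !eqxx.
by case: parity; case: eqP => _ /=; lra.
Qed.

Lemma height_le g : height (fg_word g) <= (len (toggle (fun=> true) g))%:R.
Proof.
case: g => [[|p w] red] //=; rewrite -add1n natrD lerD2l /run_height.
by rewrite lerBlDr lerDl mulr_ge0.
Qed.

Lemma avg_iter_len_toggle n :
  n%:R * (9 / 16) <= iter n avg (fun h => (len (toggle (fun=> true) h))%:R) 1%g.
Proof.
apply: (@le_trans _ _ (iter n avg (fun h => height (fg_word h)) 1%g)).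
  by have := iter_avg_subharmonic n 1%g avg_height; rewrite add0r.
by apply: le_iter_avg => h _; exact: height_le.
Qed.

End Averaging.

(** * Expectations for the push-forward chain *)

Section WalkExpectation.
Local Open Scope classical_set_scope.
Local Open Scope ring_scope.
Local Open Scope ereal_scope.
Variable R : realType.

Lemma step_prob_ge0 (T : choiceType) (p : markov_chain R T) n x y :
  0 <= step_prob p n x y.
Proof.
elim: n x => [|n IHn] x /=; first by case: eqP.
by apply: esum_ge0 => z _; rewrite mule_ge0 // lee_fin trans_ge0.
Qed.

Lemma neighbourF2E g : neighbourF2 g = [seq (g * letterF2 l)%g | l <- letters].
Proof.
rewrite /neighbourF2 /letters /=.
by congr [:: _; _; _; _]; congr (g * _)%g; exact: val_inj.
Qed.

Lemma esum_srw g (a : F2 -> \bar R) : (forall h, 0 <= a h) ->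
  \esum_(h in [set: F2]) (srwF2 R g h)%:E * a h =
    \sum_(l <- letters) (4^-1)%:E * a (g * letterF2 l)%g.
Proof.
move=> a0; have q0 : 0 <= (4^-1 : R)%:E by rewrite lee_fin invr_ge0.
transitivity (\esum_(h in [set: F2])
    (\sum_(t <- neighbourF2 g) if h == t then (4^-1)%:E * a h else 0)).
  apply: eq_esum => h _; rewrite -big_mkcond /= big_const_seq /srwF2_trans.
  rewrite (eq_count (a2 := pred1 h)); last by move=> t; rewrite /= eq_sym.
  rewrite count_uniq_mem ?neighbourF2_uniq //.
  by case: (h \in _); rewrite /= ?adde0 ?mul0e.
rewrite esum_sum; last by move=> h t _ _; case: ifP => // _; rewrite mule_ge0.
rewrite neighbourF2E big_map; apply: eq_bigr => l _.
set t := (g * _)%g.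
rewrite -[RHS](@esum_set1 R F2 t (fun h => (4^-1)%:E * a h)) ?mule_ge0 //.
rewrite [RHS]esum_mkcond; apply: eq_esum => h _.
by case: eqP => [->|neq_ht]; [rewrite mem_set | rewrite memNset].
Qed.

Variables (f finv : F2 -> F2) (fK : cancel f finv) (finvK : cancel finv f).
Let walk := push_forward (srwF2 R) fK finvK.

Lemma step_prob_pushS n g y : step_prob walk n.+1 (f g) y =
  \sum_(l <- letters) (4^-1)%:E * step_prob walk n (f (g * letterF2 l)%g) y.
Proof.
rewrite /= (@reindex_esum R F2 F2 [set: F2] [set: F2] f); last first.
  by rewrite setTT_bijective; exists finv.
under eq_esum do rewrite !fK.
by rewrite (@esum_srw g (fun h => step_prob walk n (f h) y)) // => h;
  exact: step_prob_ge0.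
Qed.

(** The push-forward started at f g is the image under f of the walk started at
    g.  The induction is over all phi, since the factor 1/4 of the first step is
    moved into phi. *)
Lemma expect_stepE n g (phi : F2 -> R) : (forall h, (0 <= phi h)%R) ->
  expect_step walk n (f g) phi = (iter n (@avg R) (fun h => phi (f h)) g)%:E.
Proof.
elim: n g phi => [|n IHn] g phi phi0; rewrite /expect_step.
  rewrite -[RHS](@esum_set1 R F2 (f g) (fun y => (phi y)%:E)) ?lee_fin //.
  rewrite [RHS]esum_mkcond; apply: eq_esum => y _ /=.
  case: eqP => [<-|ny]; first by rewrite mem_set // mul1e.
  by rewrite memNset ?mul0e // => /= e; apply: ny.
transitivity (\esum_(y in [set: F2]) \sum_(l <- letters)
    step_prob walk n (f (g * letterF2 l)%g) y * (4^-1 * phi y)%:E).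
  apply: eq_esum => y _; rewrite step_prob_pushS ge0_sume_distrl; last first.
    by move=> l _; rewrite mule_ge0 ?lee_fin ?invr_ge0 ?step_prob_ge0.
  by apply: eq_bigr => l _; rewrite EFinM muleCA muleA.
rewrite esum_sum; last first.
  move=> y l _ _; rewrite mule_ge0 ?step_prob_ge0 // lee_fin mulr_ge0 //.
transitivity (\sum_(l <- letters)
    (4^-1 * iter n (@avg R) (fun h => phi (f h)) (g * letterF2 l)%g)%:E).
  apply: eq_bigr => l _; rewrite -iter_avgZ.
  rewrite -(IHn _ (fun y => 4^-1 * phi y)%R) //.
  by move=> h; rewrite mulr_ge0.
by rewrite sumEFin -mulr_sumr mulrC.
Qed.

End WalkExpectation.

(** * Oscillation of the mean speed *)

Section Oscillation.
Local Open Scope ring_scope.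
Variable R : realType.

(** With base 64, the runs of the earlier scales change the speed at time
    64^(j+1) by at most 1/64, a quarter of the gap 9/16 - 1/2. *)
Definition schedule (i : nat) : bool := odd (trunc_log 64 i).

Lemma schedule_const j i : (64 ^ j <= i < 64 ^ j.+1)%N -> schedule i = odd j.
Proof. by move=> ij; rewrite /schedule (trunc_log_eq _ ij). Qed.

Definition mean_len n : R :=
  iter n (@avg R) (fun h => (len (toggle schedule h))%:R) 1%g.

Lemma mean_speed_toggle n :
  mean_speed (push_forward (srwF2 R) (toggleK schedule) (toggleK schedule))
    (word_metric R std_genF2) (toggle schedule 1%g) n = (mean_len n / n%:R)%:E.
Proof.
rewrite /mean_speed expect_stepE => [|h]; last by rewrite word_metricE.
rewrite -EFinM /mean_len.
by under eq_fun do rewrite word_metricE toggle1 invg1 mul1g.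
Qed.

Lemma iter_avgD n (c : R) phi g :
  iter n (@avg R) (fun h => phi h + c) g = iter n (@avg R) phi g + c.
Proof.
elim: n g => //= n IHn g; rewrite /avg; under eq_bigr do rewrite IHn.
by rewrite !big_cons !big_nil; lra.
Qed.

Lemma le_iter_avg_toggle (s t : nat -> bool) K n :
    (forall i, (K <= i < n)%N -> s i = t i) ->
  iter n (@avg R) (fun h => (len (toggle s h))%:R) 1%g <=
  iter n (@avg R) (fun h => (len (toggle t h))%:R) 1%g + K%:R.
Proof.
move=> st; rewrite -iter_avgD; apply: le_iter_avg => h /= hn.
by rewrite -natrD ler_nat; apply: (len_toggle_agree st).
Qed.

Lemma mean_speed_even j n : n = (64 ^ j.+1)%N -> ~~ odd j ->
  mean_len n / n%:R <= 34 / 64.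
Proof.
move=> nE oj; have n64 : (64 <= n)%N by rewrite nE expnS leq_pmulr ?expn_gt0.
rewrite ler_pdivrMr ?ltr0n; last by lia.
have := @le_iter_avg_toggle schedule (fun=> false) (64 ^ j) n.
rewrite -/(mean_len n) => /(_ _)/le_trans; apply.
  by move=> i; rewrite nE => /schedule_const ->; rewrite (negPf oj).
have -> : (64 ^ j)%:R = n%:R / 64 :> R by rewrite nE expnS natrM mulrC mulKf.
under eq_fun do rewrite toggle_false.
have := @avg_iter_len R n 1%g; rewrite add0r.
by move: n64; rewrite -(ler_nat R); lra.
Qed.

Lemma mean_speed_odd j n : n = (64 ^ j.+1)%N -> odd j ->
  35 / 64 <= mean_len n / n%:R.
Proof.
move=> nE oj; have n0 : (0 < n)%N by rewrite nE expn_gt0.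
rewrite ler_pdivlMr ?ltr0n //.
have := @le_iter_avg_toggle (fun=> true) schedule (64 ^ j) n.
rewrite -/(mean_len n) => /(_ _)/(le_trans (avg_iter_len_toggle R n)).
have -> : (64 ^ j)%:R = n%:R / 64 :> R by rewrite nE expnS natrM mulrC mulKf.
suff: forall i, (64 ^ j <= i < n)%N -> true = schedule i.
  by move=> H /(_ H); lra.
by move=> i; rewrite nE => /schedule_const ->; rewrite oj.
Qed.

Local Open Scope classical_set_scope.

Lemma toggle_no_drift :
  ~ has_drift (push_forward (srwF2 R) (toggleK schedule) (toggleK schedule))
      (word_metric R std_genF2) (toggle schedule 1%g).
Proof.
rewrite /has_drift; set u := mean_speed _ _ _ => cvg_u.
have sub_cvg b : u (64 ^ (i.*2 + b).+1)%N @[i --> \oo] --> limn u.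
  apply: cvg_comp cvg_u; apply/cvgnyPge => A; near=> i.
  have /leq_trans -> // : (A <= i)%N by near: i; exact: nbhs_infty_ge.
  have : ((i.*2 + b).+1 < 64 ^ (i.*2 + b).+1)%N by rewrite ltn_expl.
  by lia.
have le_lim : (limn u <= (34 / 64)%:E)%E.
  apply: (cvge_to_le (sub_cvg 0%N)).
  apply: nearW => i; rewrite /u mean_speed_toggle lee_fin.
  by apply: mean_speed_even erefl _; rewrite addn0 odd_double.
have ge_lim : ((35 / 64)%:E <= limn u)%E.
  apply: (cvge_to_ge (sub_cvg 1%N)).
  apply: nearW => i; rewrite /u mean_speed_toggle lee_fin.
  by apply: mean_speed_odd erefl _; rewrite oddD odd_double.
by have := le_trans ge_lim le_lim; rewrite lee_fin; lra.
Unshelve. all: by end_near.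
Qed.

End Oscillation.

Theorem theorem2 (R : realType) :
  exists (f finv : F2 -> F2) (fK : cancel f finv) (finvK : cancel finv f),
    quasi_isometry (word_metric R std_genF2) (word_metric R std_genF2) f /\
    ~ has_drift (push_forward (srwF2 R) fK finvK)
        (word_metric R std_genF2) (f 1%g).
Proof.
exists (toggle schedule), (toggle schedule).
exists (toggleK schedule), (toggleK schedule).
by split; [exact: toggle_quasi_isometry | exact: toggle_no_drift].
Qed.
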